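(* The number of isomorphism classes of $2$-reductive involutory medial quandles of order $n$ is at least $2^{\frac14 n^2-O(n\log n)}$.
   Context: A quandle is a non-empty set $Q$ with a binary operation such that for all $x,y,z$: $xx=x$; $x(yz)=(xy)(xz)$; and $xu=y$ has a unique solution $u\in Q$. Its order is $|Q|$. It is medial if $(xy)(uv)=(xu)(yv)$ for all $x,y,u,v\in Q$; $2$-reductive if $(xy)y=y$ for all $x,y\in Q$; involutory if $x(xy)=y$ for all $x,y\in Q$. The asymptotic notation refers to $n\to\infty$. *)

(* Defs.v *)
From HB Require Import structures.
From mathcomp Require Import all_boot all_order all_algebra.
From mathcomp Require Import all_classical all_reals all_analysis.

Set Implicit Arguments.
Unset Strict Implicit.
Unset Printing Implicit Defensive.

Definition is_quandle (Q : Type) (op : Q -> Q -> Q) : Prop :=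
  [/\ inhabited Q,
      forall x, op x x = x,
      forall x y z, op x (op y z) = op (op x y) (op x z)
    & forall x y, exists! u, op x u = y].

Definition is_medial (Q : Type) (op : Q -> Q -> Q) : Prop :=
  forall x y u v, op (op x y) (op u v) = op (op x u) (op y v).

Definition is_2reductive (Q : Type) (op : Q -> Q -> Q) : Prop :=
  forall x y, op (op x y) y = y.

Definition is_involutory (Q : Type) (op : Q -> Q -> Q) : Prop :=
  forall x y, op x (op x y) = y.

Definition isomorphic (Q Q' : Type) (op : Q -> Q -> Q) (op' : Q' -> Q' -> Q')
    : Prop :=
  exists phi : Q -> Q',
    bijective phi /\ forall x y, phi (op x y) = op' (phi x) (phi y).

(* Every structure of order n has an isomorphic copy on 'I_n, so isomorphism
   classes are counted among the operations on 'I_n. *)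
Definition binop (n : nat) := {ffun 'I_n -> {ffun 'I_n -> 'I_n}}.

Definition binop_iso (n : nat) : rel (binop n) :=
  fun f g => `[< isomorphic (fun x y => f x y) (fun x y => g x y) >].

Definition red2_inv_medial_quandles (n : nat) : {set binop n} :=
  [set f : binop n |
    let op := fun x y => f x y in
    `[< [/\ is_quandle op, is_medial op, is_2reductive op
          & is_involutory op] >]]%SET.

Definition nb_red2_inv_medial_quandles (n : nat) : nat :=
  #|equivalence_partition (@binop_iso n) (red2_inv_medial_quandles n)|.

(* Main.v *)
Require Import Defs.
From HB Require Import structures.
From mathcomp Require Import all_boot all_order all_algebra.
From mathcomp Require Import all_classical all_reals all_analysis.
From mathcomp Require Import perm zify lra.
Import Order.TTheory GRing.Theory Num.Theory.
Import numFieldNormedType.Exports.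
Local Open Scope classical_set_scope.
Local Open Scope ring_scope.

(** The count is that of a single explicit family.  Split the $n$ points into
    $m = \lfloor n/2 \rfloor$ pairs, plus one isolated point when $n$ is odd,
    and let a set $S$ of ordered pairs $(i, j)$ with $i \neq j$ decide which
    pairs of points get swapped: a point of the pair $i$ exchanges the two
    points of the pair $j$ exactly when $(i, j) \in S$, and the isolated point
    neither moves anything nor is moved.  The translation by $x$ then depends
    only on the pair containing $x$, which no translation changes, and the
    translations are commuting involutions; the quandle axioms, mediality,
    2-reductivity and involutivity follow ([toggle_red2_inv_medial]).
    Distinct sets $S$ give distinct operations, so this produces
    $2^{m^2 - m} \geq 2^{n^2/4 - n}$ operations on $n$ points.

    An isomorphism class among operations on a fixed $n$-element set is an
    orbit under the conjugation action of the permutations, so it has at most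
    $n! \leq n^n = 2^{n \log_2 n}$ members.  Dividing
    ([card_le_nb_red2_inv_medial_quandles]) leaves at least
    $2^{n^2/4 - E(n)}$ classes, where $E(n) = n + n \log_2 n = O(n \log n)$. *)

(** * Isomorphism classes of operations on a finite set *)

Definition conj_binop {n : nat} (f : binop n) (s : {perm 'I_n}) : binop n :=
  [ffun x => [ffun y => s (f (s^-1 x)%g (s^-1 y)%g)]].

Lemma iso_conj_binop (n : nat) (f g : binop n) :
  binop_iso f g -> exists s : {perm 'I_n}, g = conj_binop f s.
Proof.
move=> /asboolP[phi [phi_bij phiM]].
exists (perm (bij_inj phi_bij)).
apply/ffunP => x; rewrite ffunE; apply/ffunP => y; rewrite ffunE.
by rewrite permE phiM -2!(permE (bij_inj phi_bij)) !permKV.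
Qed.

Lemma card_iso_class_le (n : nat) (D : {set binop n}) (f : binop n) :
  (#|[set g in D | binop_iso f g]%SET| <= n ^ n)%N.
Proof.
have sub : [set g in D | binop_iso f g]%SET
    \subset [set conj_binop f s | s : {perm 'I_n}]%SET.
  apply/fintype.subsetP => g; rewrite inE => /andP[_ /iso_conj_binop[s ->]].
  exact: imset_f.
apply: leq_trans (fintype.subset_leq_card sub) _.
apply: leq_trans (leq_imset_card _ _) _.
have -> : (n ^ n)%N = #|{ffun 'I_n -> 'I_n}| by rewrite card_ffun !card_ord.
exact: leq_card val_inj.
Qed.

(** Counting by classes: the classes cover the set, and none has more than
    $n^n$ members. *)
Lemma card_le_nb_red2_inv_medial_quandles (n : nat) :
  (#|red2_inv_medial_quandles n| <= nb_red2_inv_medial_quandles n * n ^ n)%N.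
Proof.
rewrite /nb_red2_inv_medial_quandles; set D := red2_inv_medial_quandles n.
set P := equivalence_partition _ _.
have sub : D \subset finset.cover P.
  apply/fintype.subsetP => f fD; apply/finset.bigcupP.
  exists [set g in D | binop_iso f g]%SET; first exact: imset_f.
  rewrite inE fD; apply/asboolP; exists id; split => //.
  by exists id.
apply: leq_trans (fintype.subset_leq_card sub) _.
apply: leq_trans (leq_card_cover P).1 _.
rewrite -sum_nat_const; apply: leq_sum => _ /imsetP[f _ ->].
exact: card_iso_class_le.
Qed.

(** * Quandles made of pairs that swap one another *)

(** The $m$ pairs of points, and $r$ isolated points. *)
Definition pairs (m r : nat) := (('I_m * bool) + 'I_r)%type.

Definition toggle {m r : nat} (S : {set 'I_m * 'I_m}) (x y : pairs m r) :
    pairs m r :=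
  match x, y with
  | inl (i, _), inl (j, b) => inl (j, b (+) ((i, j) \in S))
  | _, _ => y
  end.

Definition off_diag (m : nat) : {set 'I_m * 'I_m} :=
  [set p : 'I_m * 'I_m | p.1 != p.2]%SET.

(** Idempotence and 2-reductivity are where the diagonal matters: a pair must
    not swap its own two points, and $xy$ lies in the same pair as $y$. *)
Lemma toggle_red2_inv_medial (m r : nat) (S : {set 'I_m * 'I_m}) :
    (0 < m + r)%N -> S \subset off_diag m ->
  [/\ is_quandle (@toggle m r S), is_medial (@toggle m r S),
      is_2reductive (@toggle m r S) & is_involutory (@toggle m r S)].
Proof.
move=> mr_gt0 /fintype.subsetP Soff.
have Sii i : (i, i) \in S = false.
  by apply/negP => /Soff; rewrite inE eqxx.
have invol : is_involutory (@toggle m r S).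
  by move=> [[i a]|u] [[j b]|v] //=; rewrite addbK.
split => //.
- split.
  + case: m r mr_gt0 {S Soff Sii invol} => [|m] [|r] // _.
    * by apply: inhabits; right; exact: ord0.
    * by apply: inhabits; left; exact: (ord0, true).
    * by apply: inhabits; right; exact: ord0.
  + by move=> [[i a]|u] //=; rewrite Sii addbF.
  + by move=> [[i a]|u] [[j b]|v] [[k c]|w] //=; rewrite addbAC.
  + move=> x y; exists (toggle S x y); split; first exact: invol.
    by move=> u <-; exact: invol.
- by move=> [[i a]|x] [[j b]|y] [[k c]|u] [[l d]|v] //=; rewrite addbAC.
- by move=> [[i a]|x] [[j b]|y] //=; rewrite Sii addbF.
Qed.

Lemma toggle_inj (m r : nat) (S S' : {set 'I_m * 'I_m}) :
  (forall x y : pairs m r, toggle S x y = toggle S' x y) -> S = S'.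
Proof.
move=> eqSS'; apply/finset.setP => -[i j].
by have [] := eqSS' (inl (i, false)) (inl (j, false)).
Qed.

Lemma card_off_diag_ge (m : nat) : (m * m - m <= #|off_diag m|)%N.
Proof.
have := cardsC (off_diag m); rewrite card_prod card_ord => <-.
have sub : ~: off_diag m \subset [set (i, i) | i : 'I_m]%SET.
  apply/fintype.subsetP => -[i j]; rewrite !inE negbK /= => /eqP ->.
  exact: imset_f.
have := leq_trans (fintype.subset_leq_card sub) (leq_imset_card _ _).
by rewrite card_ord; lia.
Qed.

(** * Transport to the standard set of n points *)

Definition transport {n : nat} {T : Type} (h : T -> 'I_n) (k : 'I_n -> T)
    (op : T -> T -> T) : binop n :=
  [ffun x => [ffun y => h (op (k x) (k y))]].

Lemma transport_red2_inv_medial (n : nat) (T : Type) (h : T -> 'I_n)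
    (k : 'I_n -> T) (op : T -> T -> T) : cancel h k -> cancel k h ->
    [/\ is_quandle op, is_medial op, is_2reductive op & is_involutory op] ->
  transport h k op \in red2_inv_medial_quandles n.
Proof.
move=> hK kH [[[x0] idem dist sol] med red inv]; rewrite inE; apply/asboolP.
have invol : is_involutory (fun x y => transport h k op x y).
  by move=> x y; rewrite !ffunE hK inv kH.
split => //.
- split.
  + exact: inhabits (h x0).
  + by move=> x; rewrite !ffunE idem kH.
  + by move=> x y z; rewrite !ffunE !hK dist.
  + move=> x y; exists (transport h k op x y); split; first exact: invol.
    by move=> u <-; exact: invol.
- by move=> x y u v; rewrite !ffunE !hK med.
- by move=> x y; rewrite !ffunE !hK red kH.
Qed.

Lemma card_red2_inv_medial_quandles_ge (n : nat) : (0 < n)%N ->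
  (2 ^ (n./2 * n./2 - n./2) <= #|red2_inv_medial_quandles n|)%N.
Proof.
move=> n_gt0; set m := n./2; pose r : nat := odd n.
have nE : (m * 2 + r = n)%N by rewrite /m /r; lia.
have cardT : #|{: pairs m r}| = n.
  by rewrite card_sum card_prod !card_ord card_bool.
pose h (x : pairs m r) : 'I_n := cast_ord cardT (enum_rank x).
pose k (x : 'I_n) : pairs m r := enum_val (cast_ord (esym cardT) x).
have hK : cancel h k by move=> x; rewrite /h /k cast_ordK enum_rankK.
have kH : cancel k h by move=> x; rewrite /h /k enum_valK cast_ordKV.
pose F (S : {set 'I_m * 'I_m}) := transport h k (toggle S).
have F_inj : injective F.
  move=> S S' eqF; apply: (@toggle_inj m r) => x y.
  apply: (can_inj hK); have := congr1 (fun f : binop n => f (h x) (h y)) eqF.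
  by rewrite !ffunE !hK.
have sub : F @: powerset (off_diag m) \subset red2_inv_medial_quandles n.
  apply/fintype.subsetP => _ /imsetP[S /[!powersetE] Soff ->].
  apply: transport_red2_inv_medial => //.
  by apply: toggle_red2_inv_medial => //; lia.
apply: leq_trans (fintype.subset_leq_card sub).
by rewrite card_imset // card_powerset leq_exp2l // card_off_diag_ge.
Qed.

(** * Asymptotics *)

Lemma half_sqr_sub_ge (R : realType) (n : nat) :
  4^-1 * n%:R ^+ 2 - n%:R <= (n./2 * n./2 - n./2)%:R :> R.
Proof.
have : (n ^ 2 <= 4 * (n./2 * n./2 - n./2) + 4 * n)%N.
  by have := odd_double_half n; case: (odd n) => /=; nia.
by rewrite -(ler_nat R) natrX natrD !natrM; lra.
Qed.

(** The bound $n^n$ on the size of a class, as a power of 2: this is the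
    $n \log_2 n$ lost in the exponent. *)
Lemma powR2_log (R : realType) (n : nat) : (0 < n)%N ->
  2 `^ (n%:R * ln n%:R / ln 2) = (n ^ n)%:R :> R.
Proof.
move=> n_gt0; have n_pos : 0 < n%:R :> R by rewrite ltr0n.
have ln2_neq0 : ln 2 != 0 :> R by rewrite gt_eqF // ln_gt0 // ltr1n.
rewrite /powR pnatr_eq0 /= divfK // natrX.
by rewrite expRM_natl lnK.
Qed.

Theorem theorem8p1 (R : realType) :
  exists2 E : nat -> R,
    E =O_\oo (fun n : nat => n%:R * ln (n%:R : R))
  & forall n : nat, (0 < n)%N ->
      2 `^ (4^-1 * n%:R ^+ 2 - E n)
        <= (nb_red2_inv_medial_quandles n)%:R.
Proof.
have ln2_gt0 : 0 < ln 2 :> R by rewrite ln_gt0 // ltr1n.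
exists (fun n => n%:R + n%:R * ln n%:R / ln 2); last first.
- move=> n n_gt0.
  have nn_gt0 : 0 < (n ^ n)%:R :> R by rewrite ltr0n expn_gt0 n_gt0.
  have two_neq0 : (2 : R) != 0 by rewrite pnatr_eq0.
  rewrite opprD addrA powRB ?two_neq0 ?implybT // powR2_log //.
  rewrite ler_pdivrMr // -natrM.
  have := leq_trans (card_red2_inv_medial_quandles_ge _ n_gt0)
                    (card_le_nb_red2_inv_medial_quandles n).
  rewrite -(ler_nat R); apply: le_trans.
  rewrite natrX -[leRHS]powR_mulrn //; apply: ler_powR; first by rewrite ler1n.
  exact: half_sqr_sub_ge.
  (* For n >= 2 both summands of E are at most (n ln n) / ln 2. *)
- apply/eqO_exP; exists (2 / ln 2); first by rewrite divr_gt0.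
  near=> n.
  have n_ge2 : (2 <= n)%N by near: n; exact: nbhs_infty_ge.
  have ln_n : ln 2 <= ln n%:R :> R.
    by rewrite ler_ln ?posrE ?ltr0n ?ler_nat //; lia.
  have n_ge0 : 0 <= n%:R :> R by [].
  have le_n : n%:R <= n%:R * ln n%:R / ln 2 :> R.
    by rewrite ler_pdivlMr // ler_wpM2l.
  rewrite !ger0_norm; [lra | nra | lra].
Unshelve. all: by end_near.
Qed.
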